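(* For all integers $m\ge -1$ and $p\ge 1$, $$\langle K_m,p\rangle=\{pf_{m+1}+(\lfloor\phi p\rfloor+1)f_{m}-1,\ \ldots,\ (p+1)f_{m+1}+(\lfloor\phi p\rfloor+1)f_{m}-2\},$$ the set of all consecutive integers from the first listed value to the last.
   Context: Here $\phi=\frac{\sqrt5-1}{2}$ and $\lfloor\cdot\rfloor$ is the floor function. The Fibonacci sequence $\mathbb{F}$ is the infinite word over $\{a,b\}$ that begins with $a$ and is fixed by the morphism $\sigma$ with $\sigma(a)=ab$, $\sigma(b)=a$; letters are indexed from $1$. Put $F_{-1}=b$ and $F_m=\sigma^m(a)$ for $m\ge 0$; $|F_m|=f_m$, where $f_{-1}=f_0=1$ and $f_{m+1}=f_m+f_{m-1}$ for $m\ge 0$. Let $\delta_m$ be the last letter of $F_m$. The $m$-th singular word ($m\ge -1$) is $K_m=\delta_{m+1}F_m\delta_m^{-1}$, i.e. $F_m$ with its last letter deleted and $\delta_{m+1}$ prepended; thus $K_{-1}=a$, $K_0=b$, $K_1=aa$, $K_2=bab$. For a nonempty factor $\omega$ of $\mathbb{F}$, $Ker(\omega)$ is the maximal singular word occurring in $\omega$, i.e. $K_m$ with the largest index $m$ such that $K_m$ is a factor of $\omega$. For a factor $\omega$ and $p\ge1$, $P(\omega,p)$ is the position in $\mathbb{F}$ of the last letter of the $p$-th occurrence of $\omega$ (overlapping occurrences allowed, ordered from left to right). Let $\mathcal{P}$ be the set of palindromes (nonempty words equal to their reversal) occurring in $\mathbb{F}$, and set $\langle K_m,p\rangle=\{P(\omega,p):\omega\in\mathcal{P},\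 Ker(\omega)=K_m\}$. *)

(* Defs.v *)
From HB Require Import structures.
From mathcomp Require Import all_boot all_order all_algebra.
From mathcomp Require Import classical_sets reals.

Set Implicit Arguments.
Unset Strict Implicit.
Unset Printing Implicit Defensive.

Import Order.TTheory GRing.Theory Num.Theory.
Local Open Scope classical_set_scope.
Local Open Scope ring_scope.

Inductive letter := La | Lb.

Definition bool_of_letter (x : letter) : bool := if x is La then true else false.
Definition letter_of_bool (x : bool) : letter := if x then La else Lb.
Lemma bool_of_letterK : cancel bool_of_letter letter_of_bool.
Proof. by case. Qed.

HB.instance Definition _ := Finite.copy letter (can_type bool_of_letterK).

Definition sigma1 (x : letter) : seq letter :=
  if x is La then [:: La; Lb] else [:: La].
Definition sigma (u : seq letter) : seq letter := flatten (map sigma1 u).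

(* An infinite word is a function w : nat -> letter whose letters are
   w 1, w 2, ...; the value w 0 is never used. *)
Definition word_prefix (w : nat -> letter) (n : nat) : seq letter :=
  map w (iota 1 n).

(* sigma w = w for an infinite word w says that the infinite concatenation
   sigma (w 1) ++ sigma (w 2) ++ ... is w, i.e. that the image of every prefix
   of w is the prefix of w of the same length. *)
Definition sigma_fixed (w : nat -> letter) : Prop :=
  forall n, sigma (word_prefix w n) =
            word_prefix w (size (sigma (word_prefix w n))).

Definition fibonacci_sequence (w : nat -> letter) : Prop :=
  w 1%N = La /\ sigma_fixed w.

(* Indices m >= -1 are integers; the values at m < -1 are junk. *)
Definition F (m : int) : seq letter :=
  match m with
  | Posz n => iter n sigma [:: La]
  | Negz _ => [:: Lb]
  end.

Fixpoint shifted_fib (n : nat) : nat :=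
  match n with
  | 0 => 1
  | n'.+1 => match n' with
             | 0 => 1
             | n''.+1 => shifted_fib n' + shifted_fib n''
             end
  end%N.

(* f (-1) = f 0 = 1 and f (m + 1) = f m + f (m - 1) for m >= 0. *)
Definition f (m : int) : nat := shifted_fib (absz (m + 1)).

(* F m is never empty, so the default value La is not used. *)
Definition delta (m : int) : letter := last La (F m).

Definition K (m : int) : seq letter :=
  delta (m + 1) :: take (size (F m)).-1 (F m).

Definition is_Ker (u v : seq letter) : Prop :=
  exists2 m : int, -1 <= m &
    [/\ v = K m, infix (K m) u & forall j : int, m < j -> ~~ infix (K j) u].

(* Every nonempty u has a kernel (La and Lb are singular words and the size of
   K m tends to infinity), so the default value [::] is only used for
   u = [::]. *)
Definition Ker (u : seq letter) : seq letter := xget [::] [set v | is_Ker u v].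

(* The letters of w at positions e - size u + 1, ..., e spell u. *)
Definition occurs_ending_at (w : nat -> letter) (u : seq letter) (e : nat) :
    bool :=
  (size u <= e)%N && (map w (iota (e - size u).+1 (size u)) == u).

Definition is_factor (u : seq letter) (w : nat -> letter) : Prop :=
  exists e, occurs_ending_at w u e.

Definition ends_pth_occurrence (w : nat -> letter) (u : seq letter)
    (p e : nat) : Prop :=
  occurs_ending_at w u e /\ count (occurs_ending_at w u) (iota 1 e) = p.

(* For u nonempty there is at most one such position; the default value 0,
   which is not a position, stands for the absence of a p-th occurrence. *)
Definition P (w : nat -> letter) (u : seq letter) (p : nat) : nat :=
  xget 0%N [set e | ends_pth_occurrence w u p e].

Definition palindromes (w : nat -> letter) : set (seq letter) :=
  [set u | [/\ u != [::], rev u = u & is_factor u w]].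

Definition bracket (w : nat -> letter) (v : seq letter) (p : nat) : set int :=
  [set (P w u p)%:Z | u in [set u | palindromes w u /\ Ker u = v]].

Definition phi (R : realType) : R := (Num.sqrt 5 - 1) / 2.

Lemma sigma_cat u v : sigma (u ++ v) = sigma u ++ sigma v.
Proof. by rewrite /sigma map_cat flatten_cat. Qed.

Lemma size_sigma u : (size (sigma u) <= (size u).*2)%N.
Proof.
elim: u => //= x u IH; rewrite /sigma /= size_cat doubleS.
by case: x => /=; rewrite !addSn add0n ?ltnS // ltnW // ltnS.
Qed.

Lemma iter_sigma_cat n :
  exists2 t, iter n.+1 sigma [:: La] = iter n sigma [:: La] ++ t
           & (0 < size t)%N.
Proof.
elim: n => [|n [t E t0]]; first by exists [:: Lb].
exists (sigma t); first by rewrite iterS {1}E sigma_cat -iterS.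
by case: t t0 {E} => // x t _; rewrite /sigma /= size_cat; case: x.
Qed.

Lemma size_iter_sigma n : (n < size (iter n sigma [:: La]))%N.
Proof.
elim: n => // n IH; have [t -> t0] := iter_sigma_cat n.
by rewrite size_cat -(addn1 n.+1) leq_add.
Qed.

Lemma nth_iter_sigma n k i : (i <= n)%N ->
  nth La (iter (n + k) sigma [:: La]) i = nth La (iter n sigma [:: La]) i.
Proof.
move=> le_in; elim: k => [|k IH]; first by rewrite addn0.
rewrite addnS; have [t -> _] := iter_sigma_cat (n + k).
rewrite nth_cat (leq_trans _ (size_iter_sigma _)) ?IH //.
by rewrite ltnS (leq_trans le_in) ?leq_addr.
Qed.

Lemma fibonacci_sequence_exists : exists w, fibonacci_sequence w.
Proof.
pose w i := nth La (iter i.-1 sigma [:: La]) i.-1.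
have wE n N : (n <= N.+1)%N ->
    word_prefix w n = take n (iter N sigma [:: La]).
  move=> le_nN; have le_ns : (n <= size (iter N sigma [:: La]))%N.
    by apply: leq_trans le_nN (size_iter_sigma N).
  apply: (@eq_from_nth _ La) => [|i].
    by rewrite size_map size_iota size_takel.
  rewrite size_map size_iota => lt_in.
  rewrite (nth_map 0%N) ?size_iota // nth_iota // nth_take // /w add1n /=.
  have le_iN : (i <= N)%N by rewrite -ltnS (leq_trans lt_in).
  by rewrite -(subnKC le_iN) nth_iter_sigma ?subnKC.
exists w; split=> // n.
set s := size _.
have le_s : (s <= n.*2)%N.
  by rewrite (leq_trans (size_sigma _)) // size_map size_iota.
have le_n2 : (n <= n.*2.+1)%N by rewrite -addnn -addnS leq_addr.
rewrite (wE s n.*2.+1); last by rewrite (leq_trans le_s) // -addn2 leq_addr.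
have := congr1 sigma (cat_take_drop n (iter n.*2 sigma [:: La])).
rewrite sigma_cat -wE // -iterS => <-.
by rewrite take_size_cat.
Qed.

(* Main.v *)
Require Import Defs.
From HB Require Import structures.
From mathcomp Require Import all_boot all_order all_algebra.
From mathcomp Require Import classical_sets reals.
From mathcomp Require Import zify lra.

Set Implicit Arguments.
Unset Strict Implicit.
Unset Printing Implicit Defensive.

Import Order.TTheory GRing.Theory Num.Theory.
Local Open Scope classical_set_scope.
Local Open Scope ring_scope.

(** Indices are shifted to the natural numbers, n = m + 1, and positions start
at 0 unless they are ends of occurrences. The fixed point w is cut, for each n,
into sigma^n-blocks, the images under sigma^n of the letters of w; [block n q] is
the total length of the first q of them. Since sigma w = w, an
occurrence of a word that is built from images of sigma can be desubstituted
([occ_sigma]). Two families of words are transported in this way from level n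
to level n + 1.

The singular words: [occ_singular] says that the first letter of an occurrence
of K_m is the last letter of a sigma^n-block of a letter a, and that every such
block gives an occurrence. Hence two occurrences start at least f_{m+1} apart
([occ_singular_dist]), and an occurrence that is prolonged by f_{m+1} letters to
the right contains K_{m+1} or K_{m+2} ([occ_singular_next]).

The palindromic prefixes [bispecial n], of length f_{n+1} - 2: they occur at the
start of every sigma^n-block ([occ_bispecial]), and K_m is the centre of
[bispecial n.+1] ([singular_trim]). So every occurrence of K_m sits in the
middle of an occurrence of [bispecial n.+1], with f_{m+1} - 1 letters on each
side.

A palindrome with kernel K_m cannot extend f_{m+1} letters beyond K_m on either
side, and by reflection it must contain K_m exactly in its centre, as otherwise
two occurrences of K_m would be too close. Therefore the palindromes with kernel
K_m are the f_{m+1} words got from [bispecial n.+1] by deleting the same number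
of letters, fewer than f_{m+1}, at both ends ([palindrome_kernelE]). All of them
have their p-th occurrence inside the p-th occurrence of [bispecial n.+1], with
the same centre, so the ends of these occurrences are f_{m+1} consecutive
integers. The number of letters a among the first q letters of w gives the
length of the first q sigma^n-blocks ([block_num]); it equals the floor of phi (q + 1)
([floor_phi]), which yields the stated bounds. *)

(** * Lengths *)

Local Open Scope nat_scope.

Local Arguments shifted_fib n : simpl never.

Lemma shifted_fibSS n : shifted_fib n.+2 = shifted_fib n.+1 + shifted_fib n.
Proof. by []. Qed.

Lemma shifted_fib_gt0 n : 0 < shifted_fib n.
Proof.
suff: (0 < shifted_fib n) && (0 < shifted_fib n.+1) by case/andP.
elim: n => // n /andP[h1 h2]; rewrite h2 shifted_fibSS; lia.
Qed.

Lemma leq_shifted_fib i j : i <= j -> shifted_fib i <= shifted_fib j.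
Proof.
move=> /subnKC <-; elim: (j - i) => [|k IH]; first by rewrite addn0.
rewrite addnS (leq_trans IH) //; case: (i + k) => // l.
by rewrite shifted_fibSS leq_addr.
Qed.

Lemma size_sigma_count u : size (sigma u) = size u + count_mem La u.
Proof.
elim: u => // x u IH; rewrite /sigma /= size_cat -/(sigma u) IH.
by case: x => /=; lia.
Qed.

Lemma count_sigma u : count_mem La (sigma u) = size u.
Proof.
elim: u => // x u IH; rewrite /sigma /= count_cat -/(sigma u) IH.
by case: x => /=; lia.
Qed.

(** * Singular words *)

(** The word F_{n-1}. Starting from b makes the recursion uniform, since
sigma maps F_{-1} = b to F_0 = a. *)
Definition fword n := iter n sigma [:: Lb].

(** The last letter of F_{n-1}. *)
Definition parity_letter n := if odd n then La else Lb.

Definition fword_trunc n := take (size (fword n)).-1 (fword n).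

(** The singular word K_{n-1}. *)
Definition singular n := parity_letter n.+1 :: fword_trunc n.

Lemma fwordE n : F (n%:Z - 1) = fword n.
Proof.
case: n => // n; rewrite (_ : (n.+1%:Z - 1)%R = n%:Z); last lia.
by rewrite /fword iterSr.
Qed.

Lemma fword_rcons n : fword n = rcons (fword_trunc n) (parity_letter n).
Proof.
suff [u E] : exists u, fword n = rcons u (parity_letter n).
  by rewrite /fword_trunc E size_rcons -!cats1 take_size_cat.
elim: n => [|n [u E]]; first by exists [::].
rewrite /fword iterS -/(fword n) E -cats1 sigma_cat /parity_letter /=.
case: (odd n) => /=.
  by exists (sigma u ++ [:: La]); rewrite -cats1 -catA.
by exists (sigma u); rewrite -cats1.
Qed.

Lemma size_fword n : size (fword n) = shifted_fib n.
Proof.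
suff [] : size (fword n) = shifted_fib n /\
          size (fword n.+1) = shifted_fib n.+1 by [].
elim: n => // n [IH1 IH2]; split=> //.
rewrite /fword iterS size_sigma_count {2}iterS count_sigma -!/(fword _).
by rewrite IH1 IH2.
Qed.

Lemma size_singular n : size (singular n) = shifted_fib n.
Proof.
by rewrite -size_fword fword_rcons size_rcons.
Qed.

Lemma singularE n : K (n%:Z - 1) = singular n.
Proof.
rewrite /K /delta fwordE.
rewrite (_ : (n%:Z - 1 + 1)%R = (n.+1%:Z - 1)%R); last lia.
by rewrite fwordE fword_rcons last_rcons.
Qed.

Lemma fE n : f (n%:Z - 1) = shifted_fib n.
Proof. by rewrite /f (_ : (n%:Z - 1 + 1)%R = n%:Z) //; lia. Qed.

(** With [sigma_singular_odd], this passes from one singular word to the next: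
up to a letter a at one of the two ends, sigma maps K_{n-1} to K_n, and the
parity of n decides on the end. *)
Lemma sigma_singular_even n : ~~ odd n ->
  La :: singular n.+1 = sigma (singular n).
Proof.
move=> ev; have := fword_rcons n.+1.
rewrite /fword iterS -/(fword n) fword_rcons -cats1 sigma_cat.
rewrite /singular /parity_letter /= !negbK (negbTE ev) /=.
by rewrite cats1 -[sigma (La :: _)]/([:: La; Lb] ++ sigma _) => /rcons_inj[->].
Qed.

Lemma sigma_singular_odd n : odd n ->
  singular n.+1 = sigma (singular n) ++ [:: La].
Proof.
move=> od; have := fword_rcons n.+1.
rewrite /fword iterS -/(fword n) fword_rcons -cats1 sigma_cat.
rewrite /singular /parity_letter /= !negbK od /=.
rewrite -[flatten _]/(sigma _) -[sigma [:: La]]/([:: La] ++ [:: Lb]) catA.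
by rewrite !cats1 => /rcons_inj[<-].
Qed.

Lemma last_singular n : last Lb (singular n) = parity_letter n.+1.
Proof.
elim: n => // n IH; case od: (odd n).
  by rewrite sigma_singular_odd // cats1 last_rcons /parity_letter /= od.
have -> : last Lb (singular n.+1) = last Lb (La :: singular n.+1) by [].
rewrite sigma_singular_even ?od //; case/lastP: (singular n) IH => [|v c].
  by rewrite /parity_letter /= od.
rewrite last_rcons /parity_letter /= od => ->.
by rewrite -cats1 sigma_cat last_cat.
Qed.

(** * Palindromic prefixes *)

(** The palindromic prefixes of the Fibonacci sequence: the empty word, a, aba,
abaaba, and so on. Their length f_{n+1} - 2 is that of the longest common prefix of
the images under sigma^n of two infinite factors that begin with different
letters. *)
Fixpoint bispecial n :=
  if n is n'.+1 then sigma (bispecial n') ++ [:: La] else [::].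

(** The induction has to carry the number of letters a along, because that
number is what sigma adds to the length. *)
Lemma size_bispecial n : (size (bispecial n)).+2 = shifted_fib n.+2.
Proof.
suff [] : (size (bispecial n)).+2 = shifted_fib n.+2 /\
          (count_mem La (bispecial n)).+1 = shifted_fib n.+1 by [].
elim: n => // n [IH1 IH2].
rewrite /= size_cat count_cat size_sigma_count count_sigma /=.
move: IH1 IH2; rewrite !shifted_fibSS.
by move: (count_mem _ _) => c; lia.
Qed.

Lemma size_bispecialS n :
  (size (bispecial n.+1)).+2 = (shifted_fib n.+1).*2 + shifted_fib n.
Proof. by rewrite size_bispecial !shifted_fibSS -addnn; lia. Qed.

Lemma leq_double_size_bispecial n k : k < shifted_fib n.+1 ->
  k.*2 <= size (bispecial n.+1).
Proof. by have := size_bispecialS n; have := shifted_fib_gt0 n; lia. Qed.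

(** Reversal turns sigma into the conjugate morphism a -> ba, b -> a, and
conjugating back by the letter a is what the extra a provides. *)
Lemma rev_sigma u : rev (sigma u ++ [:: La]) = sigma (rev u) ++ [:: La].
Proof.
elim: u => // c u IH.
have -> : sigma (c :: u) = sigma1 c ++ sigma u by [].
rewrite -catA rev_cat IH rev_cons -cats1 sigma_cat -!catA.
by congr (_ ++ _); case: c.
Qed.

Lemma rev_bispecial n : rev (bispecial n) = bispecial n.
Proof. by elim: n => // n IH; rewrite /= rev_sigma IH. Qed.

Definition trim (T : Type) k (s : seq T) := drop k (take (size s - k) s).

Lemma rev_trim (T : Type) k (s : seq T) : k.*2 <= size s ->
  rev (trim k s) = trim k (rev s).
Proof.
move=> h; rewrite /trim rev_drop rev_take size_rev size_take_min take_drop.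
by congr (drop _ (take _ _)); lia.
Qed.

Lemma size_trim (T : Type) k (s : seq T) : k.*2 <= size s ->
  size (trim k s) = size s - k.*2.
Proof. by move=> h; rewrite /trim size_drop size_take_min; lia. Qed.

Lemma trim_cat (T : Type) k (s : seq T) : k.*2 <= size s ->
  s = take k s ++ trim k s ++ drop (size s - k) s.
Proof.
move=> h; rewrite -{1}(cat_take_drop (size s - k) s) catA; congr (_ ++ _).
by rewrite -{1}(cat_take_drop k (take _ s)) take_takel //; lia.
Qed.

Lemma trim_trim (T : Type) i j (s : seq T) : (i + j).*2 <= size s ->
  trim j (trim i s) = trim (i + j) s.
Proof.
move=> h; rewrite {1}/trim size_trim; last lia.
rewrite /trim take_drop drop_drop take_takel; last lia.
by congr (drop _ (take _ _)); lia.
Qed.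

(** * Words occurring in the Fibonacci sequence *)

Section Occurrences.

Variables (w : nat -> letter) (hw : fibonacci_sequence w).

(** The word u occurs in w immediately after the first x letters. *)
Definition occ (u : seq letter) x := map w (iota x.+1 (size u)) == u.

Definition num_a q := count_mem La (word_prefix w q).

(** The length of the image under sigma of the first q letters of w. *)
Definition expand q := q + num_a q.

(** The length of the image under sigma^n of the first q letters of w. *)
Definition block n q := iter n expand q.

Lemma occ_cons c u x : occ (c :: u) x = (w x.+1 == c) && occ u x.+1.
Proof. by []. Qed.

Lemma occ_cat u v x : occ (u ++ v) x = occ u x && occ v (x + size u).
Proof.
by rewrite /occ size_cat iotaD map_cat eqseq_cat ?size_map ?size_iota.
Qed.

Lemma word_prefixD q n :
  word_prefix w (q + n) = word_prefix w q ++ map w (iota q.+1 n).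
Proof. by rewrite /word_prefix iotaD map_cat. Qed.

Lemma word_prefixS q : word_prefix w q.+1 = word_prefix w q ++ [:: w q.+1].
Proof. by rewrite -[in LHS]addn1 word_prefixD. Qed.

Lemma num_aS q : num_a q.+1 = num_a q + (w q.+1 == La).
Proof. by rewrite /num_a word_prefixS count_cat /= addn0. Qed.

Lemma num_a_gt0 q : 0 < q -> 0 < num_a q.
Proof.
case: q => // q _; rewrite -[q.+1]add1n /num_a word_prefixD.
by rewrite /word_prefix /= hw.1.
Qed.

Lemma sigma_prefix q : sigma (word_prefix w q) = word_prefix w (expand q).
Proof.
have [_ /(_ q)] := hw.
by rewrite size_sigma_count size_map size_iota.
Qed.

Lemma num_a_expand q : num_a (expand q) = q.
Proof. by rewrite /num_a -sigma_prefix count_sigma size_map size_iota. Qed.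

Lemma expandS q : expand q.+1 = expand q + size (sigma1 (w q.+1)).
Proof. by rewrite /expand num_aS; case: (w q.+1) => /=; lia. Qed.

Lemma occ_sigma1 q : occ (sigma1 (w q.+1)) (expand q).
Proof.
have := sigma_prefix q.+1; rewrite expandS word_prefixD.
rewrite word_prefixS sigma_cat sigma_prefix /sigma /= cats0.
by move=> /esym/eqP; rewrite eqseq_cat // => /andP[].
Qed.

Lemma expand_letter q : w (expand q).+1 = La.
Proof.
have := occ_sigma1 q; case: (w q.+1) => /=.
  by rewrite occ_cons => /andP[/eqP].
by rewrite occ_cons => /andP[/eqP].
Qed.

Lemma expandSa q : w q.+1 = La ->
  expand q.+1 = (expand q).+2 /\ w (expand q).+2 = Lb.
Proof.
move=> E; rewrite expandS E addn2; split=> //.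
by have := occ_sigma1 q; rewrite E !occ_cons => /and3P[_ /eqP].
Qed.

Lemma expandSb q : w q.+1 = Lb -> expand q.+1 = (expand q).+1.
Proof. by move=> E; rewrite expandS E addn1. Qed.

(** Every position of w is the first letter of the image of a letter, or the
second letter of the image ab of a letter a. *)
Lemma expandP x : (exists q, x = expand q) \/
  (exists2 q, w q.+1 = La & x = (expand q).+1).
Proof.
elim: x => [|x [[q ->]|[q qa ->]]]; first by left; exists 0.
  case E: (w q.+1); first by right; exists q.
  by left; exists q.+1; rewrite expandSb.
by left; exists q.+1; have [-> _] := expandSa qa.
Qed.

Lemma letter_a x : w x.+1 = La <-> exists q, x = expand q.
Proof.
split=> [xa|[q ->]]; last exact: expand_letter.
case: (expandP x) => // -[q qa xE].
by have [_] := expandSa qa; rewrite -xE xa.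
Qed.

Lemma letter_b x : w x.+1 = Lb -> exists2 q, w q.+1 = La & x = (expand q).+1.
Proof.
by move=> xb; case: (expandP x) => // -[q xE]; rewrite xE expand_letter in xb.
Qed.

(** The final a makes the desubstitution unambiguous: the last letter of u is b
exactly when its image a is followed by another a. *)
Lemma occ_sigma_expand u q : occ (sigma u ++ [:: La]) (expand q) = occ u q.
Proof.
elim: u q => [|c u IH] q; first by rewrite /occ /= expand_letter.
rewrite -cat1s sigma_cat -catA occ_cat occ_cons -IH.
have next : occ (sigma u ++ [:: La]) (expand q).+1 -> w (expand q).+2 = La.
  by case: (u) => [|[] v]; rewrite occ_cons => /andP[/eqP].
case: c => /=; rewrite !occ_cons expand_letter /=; case E: (w q.+1) => /=.
- by have [-> ->] := expandSa E; rewrite addn2.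
- rewrite -expandSb // expand_letter //.
- by rewrite addn1; apply/negP => /next; have [_ ->] := expandSa E.
- by rewrite addn1 expandSb.
Qed.

(** A word of the form sigma u a begins with a, and every a of w begins the
image of a letter; so its occurrences lie on block boundaries. *)
Lemma occ_sigma u x :
  occ (sigma u ++ [:: La]) x <-> exists2 q, x = expand q & occ u q.
Proof.
split=> [o|[q -> o]]; last by rewrite occ_sigma_expand.
have : w x.+1 = La by case: u o => [|[] v]; rewrite occ_cons => /andP[/eqP].
by case/letter_a=> q xE; exists q => //; rewrite -occ_sigma_expand -xE.
Qed.

(** The factor bb does not occur in w. *)
Lemma occ_next_a u x : occ (rcons u Lb) x -> occ (rcons u Lb ++ [:: La]) x.
Proof.
move=> o; rewrite occ_cat o /= occ_cons andbT size_rcons addnS.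
move: o; rewrite -cats1 occ_cat => /andP[_]; rewrite occ_cons andbT => /eqP.
case/letter_b=> q qa ->; have [<- _] := expandSa qa.
by rewrite expand_letter.
Qed.

(** * Blocks *)

Lemma blockS n q : block n.+1 q = block n (expand q).
Proof. by rewrite /block iterSr. Qed.

(** In the image under sigma^(n+1), every letter contributes f_n, and
a letter a contributes f_{n-1} more. *)
Lemma block_num n q :
  block n.+1 q = q * shifted_fib n.+1 + num_a q * shifted_fib n.
Proof.
elim: n q => [|n IH] q; first by rewrite /block /= /expand !muln1.
by rewrite blockS IH num_a_expand shifted_fibSS /expand; lia.
Qed.

Lemma block_Sa n q : w q.+1 = La -> block n q.+1 = block n q + shifted_fib n.+1.
Proof.
case: n => [|n] qa; first by rewrite /block /= addn1.
by rewrite !block_num num_aS qa shifted_fibSS /=; lia.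
Qed.

Lemma block_Sb n q : w q.+1 = Lb -> block n q.+1 = block n q + shifted_fib n.
Proof.
case: n => [|n] qb; first by rewrite /block /= addn1.
by rewrite !block_num num_aS qb /=; lia.
Qed.

Lemma block_homo n q q' : q < q' -> block n q < block n q'.
Proof.
move=> /subnKC <-; elim: (q' - q.+1) => [|k IH].
  rewrite addn0; case E: (w q.+1).
    by rewrite block_Sa //; have := shifted_fib_gt0 n.+1; lia.
  by rewrite block_Sb //; have := shifted_fib_gt0 n; lia.
rewrite addnS; apply: leq_trans IH _; case E: (w (q.+1 + k).+1).
  by rewrite block_Sa //; lia.
by rewrite block_Sb //; lia.
Qed.

Lemma leq_block n q q' : q <= q' -> block n q <= block n q'.
Proof. by rewrite leq_eqVlt => /predU1P[-> //|/(block_homo n)/ltnW]. Qed.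

(** * Occurrences of singular words *)

(** An occurrence of K_{n-1} starts at the last letter of the image of an a
under sigma^n. The first letter of K_{n-1} decides whether an occurrence of K_n
starts at the image of an occurrence of K_{n-1} or one letter later, and in both
cases this is again the last letter of a block. *)
Lemma occ_singular n x :
  occ (singular n) x <-> exists2 q, w q.+1 = La & x.+1 = block n q.+1.
Proof.
elim: n x => [|n IH] x.
  rewrite occ_cons /= andbT; split=> [/eqP ?|[q qa [->]]]; first by exists x.
  by rewrite qa.
(* One more application of sigma maps the boundary after the first letter of an
   occurrence of the singular word to the corresponding boundary. *)
have key : (exists2 q, w q.+1 = La & x.+1 = block n.+1 q.+1) <->
           exists2 y, occ (singular n) y & x.+1 = expand y.+1.
  split=> [[q qa ->]|[y /IH [q qa yE] ->]].
    have /IH o : exists2 q', w q'.+1 = La & (block n q.+1).-1.+1 = block n q'.+1.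
      exists q => //; rewrite prednK //.
      by apply: leq_ltn_trans (block_homo n (ltnSn q)).
    exists (block n q.+1).-1 => //; rewrite prednK //.
    by apply: leq_ltn_trans (block_homo n (ltnSn q)).
  by exists q; rewrite // yE.
rewrite key; case od: (odd n).
  have firstb y : occ (singular n) y -> expand y.+1 = (expand y).+1.
    rewrite occ_cons /parity_letter /= od => /andP[/eqP yb _].
    exact: expandSb.
  rewrite sigma_singular_odd // occ_sigma; split=> [[y -> o]|[y o]].
    by exists y; rewrite // firstb.
  by rewrite firstb // => -[->]; exists y.
have ev : ~~ odd n by rewrite od.
(* The next singular word begins and ends with b, and in w every b lies between
   two letters a. *)
have oE y : occ (singular n.+1) y.+1 <-> occ (sigma (singular n) ++ [:: La]) y.
  have -> : sigma (singular n) ++ [:: La] = La :: (singular n.+1 ++ [:: La]).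
    by rewrite -sigma_singular_even.
  rewrite [occ (La :: _) _]occ_cons.
  split=> [o|].
    apply/andP; split.
      move: o; rewrite occ_cons /parity_letter /= od => /andP[/eqP].
      by case/letter_b => q qa [->] _; rewrite expand_letter.
    have : last Lb (singular n.+1) = Lb.
      by rewrite last_singular /parity_letter /= negbK od.
    case/lastP E: (singular n.+1) o => [//|v c] o; rewrite last_rcons => cE.
    by rewrite cE in o *; exact: occ_next_a.
  by case/andP=> _; rewrite occ_cat => /andP[].
have firsta y : occ (singular n) y -> w y.+1 = La.
  by rewrite occ_cons /parity_letter /= od => /andP[/eqP].
split=> [o|[y o xE]].
  have x0 : 0 < x.
    rewrite lt0n; apply/eqP => xE; move: o; rewrite xE occ_cons.
    by have [-> _] := hw; rewrite /parity_letter /= od.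
  rewrite -(prednK x0) in o *; move: o => /oE/occ_sigma [y -> o].
  by exists y => //; have [-> _] := expandSa (firsta _ o).
have [E _] := expandSa (firsta _ o); rewrite E in xE.
by case: xE => ->; apply/oE/occ_sigma; exists y.
Qed.

(** To the right of the letter a of w whose sigma^n-block starts the occurrence,
there is either b, and the two form the image of a letter a, so that the
sigma^n-block of b ends where K_n starts; or another a, and then the first a is
the image of a letter b, which itself ends an image ab, so that K_{n+1} starts
where K_{n-1} does. *)
Lemma occ_singular_next n x : occ (singular n) x ->
  occ (singular n.+1) (x + shifted_fib n) \/ occ (singular n.+2) x.
Proof.
case/occ_singular => q /letter_a [q' qE] xE.
case E: (w q'.+1).
  have [E1 E2] := expandSa E; left; apply/occ_singular; exists q' => //.
  by rewrite -addSn xE blockS E1 -qE [RHS]block_Sb // qE.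
right; apply/occ_singular; have [r ra rE] := letter_b E.
exists r => //; have [E1 _] := expandSa ra.
by rewrite xE !blockS qE -(expandSb E) E1 rE.
Qed.

(** Between the two starting positions there is at least one full sigma^n-block
of a letter a, the one that ends with the first letter of the later
occurrence. *)
Lemma occ_singular_dist n x y : occ (singular n) x -> occ (singular n) y ->
  x < y -> x + shifted_fib n.+1 <= y.
Proof.
case/occ_singular => q qa xE /occ_singular [r ra yE] xy.
have qr : q < r.
  rewrite ltnNge; apply/negP => rq.
  by have := leq_block n rq; rewrite -ltnS in rq; have := leq_block n rq; lia.
by have := leq_block n qr; have := block_Sa n ra; lia.
Qed.

Lemma occ_bispecial n q : occ (bispecial n) (block n q).
Proof.
by elim: n => // n IH; rewrite /= occ_sigma_expand.
Qed.

(** * Palindromes *)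

Lemma infix_split (v u : seq letter) :
  infix v u -> exists p q : seq letter, u = p ++ v ++ q.
Proof. by case/infixP=> p [q ->]; exists p, q. Qed.

Lemma occ_inj (u v : seq letter) x :
  size u = size v -> occ u x -> occ v x -> u = v.
Proof. by rewrite /occ => -> /eqP <- /eqP. Qed.

Lemma occ_trim u k x : k.*2 <= size u -> occ u x -> occ (trim k u) (x + k).
Proof.
move=> h; rewrite {1}(trim_cat h) !occ_cat => /and3P[_ + _].
by rewrite size_takel //; lia.
Qed.

Lemma occ_infix (u v : seq letter) x s :
  occ u x -> occ v (x + s) -> s + size v <= size u -> infix v u.
Proof.
move=> ou ov h.
have uE : u = take s u ++ take (size v) (drop s u) ++ drop (size v) (drop s u).
  by rewrite !cat_take_drop.
apply/infixP; exists (take s u), (drop (size v) (drop s u)).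
rewrite {1}uE; congr (_ ++ (_ ++ _)); apply: occ_inj ov.
  by rewrite size_takel // size_drop; lia.
move: ou; rewrite {1}uE !occ_cat => /and3P[_ + _].
by rewrite size_takel //; lia.
Qed.

(** Every sigma^(n+1)-block starts with the sigma^n-block of a letter a, so the
sigma^(n+1)-blocks enumerate the occurrences of K_{n-1}. *)
Lemma occ_singular_block n x :
  occ (singular n) x <-> exists q, x.+1 = block n.+1 q + shifted_fib n.+1.
Proof.
have blockE q : block n.+1 q + shifted_fib n.+1 = block n (expand q).+1.
  by rewrite blockS block_Sa // expand_letter.
rewrite occ_singular; split=> [[q /letter_a [r ->] ->]|[q ->]].
  by exists r.
by exists (expand q); rewrite ?expand_letter.
Qed.

(** Both words occur at the same place near the beginning of w, by
[occ_singular_block] and [occ_bispecial], and their lengths agree. *)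
Lemma singular_trim n :
  singular n = trim (shifted_fib n.+1).-1 (bispecial n.+1).
Proof.
have sB := size_bispecialS n; have s1 := shifted_fib_gt0 n.+1.
have h : (shifted_fib n.+1).-1.*2 <= size (bispecial n.+1).
  by apply: leq_double_size_bispecial; rewrite prednK.
apply: (@occ_inj _ _ (block n.+1 0 + (shifted_fib n.+1).-1)).
- by rewrite size_singular size_trim //; lia.
- by apply/occ_singular_block; exists 0; lia.
- exact: occ_trim (occ_bispecial _ _).
Qed.

Lemma rev_singular n : rev (singular n) = singular n.
Proof.
rewrite singular_trim rev_trim ?rev_bispecial //.
by apply: leq_double_size_bispecial; rewrite prednK ?shifted_fib_gt0.
Qed.

(** A symmetric part of the palindromic prefix that still contains the central
singular word occurs only where the whole prefix does, since every occurrence of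
the singular word lies in the centre of an occurrence of the prefix. *)
Lemma occ_trim_bispecial n k x : k < shifted_fib n.+1 ->
  occ (trim k (bispecial n.+1)) x <-> exists q, x = block n.+1 q + k.
Proof.
move=> hk; have sB := size_bispecialS n; have s0 := shifted_fib_gt0 n.
have h := leq_double_size_bispecial hk.
split=> [o|[q ->]]; last exact: occ_trim (occ_bispecial _ _).
have : occ (singular n) (x + ((shifted_fib n.+1).-1 - k)).
  rewrite singular_trim -[X in trim X _](@subnKC k); last lia.
  rewrite -trim_trim; last lia.
  by apply: occ_trim o; rewrite size_trim //; lia.
by case/occ_singular_block=> q E; exists q; lia.
Qed.

Lemma occ_trim_bispecial0 n k : k < shifted_fib n.+1 ->
  occ (trim k (bispecial n.+1)) k.
Proof.
move=> hk; apply/(occ_trim_bispecial _ hk); exists 0.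
by rewrite block_num /num_a /= !mul0n.
Qed.

(** The prefix of w of length f_{n+2} - 2 is too short to contain K_{j-1}: even
the first occurrence of K_{j-1} in w ends at f_{j+1} - 1 >= f_{n+2} - 1. *)
Lemma singular_notin_trim n k j : k < shifted_fib n.+1 -> n < j ->
  ~~ infix (singular j) (trim k (bispecial n.+1)).
Proof.
move=> hk nj; apply/negP => /infix_split[p [q E]].
have o := occ_trim_bispecial0 hk.
have sB := size_bispecial n.+1.
have /leq_shifted_fib sj : n.+3 <= j.+2 by [].
have h := leq_double_size_bispecial hk.
have := congr1 (@size letter) E.
rewrite size_trim // (size_cat p) (size_cat (singular j)) size_singular.
move: o; rewrite E !occ_cat => /and3P[_ /occ_singular_block [r rE] _].
by have := shifted_fibSS j; lia.
Qed.

(** The part of u to the right of the kernel is shorter than f_n by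
[occ_singular_next], and so is the part to the left, because u is its own
reversal. If the two parts had different lengths p and q, reversal would give
two occurrences of the kernel at distance |p - q| < f_n, against
[occ_singular_dist]. *)
Lemma kernel_palindrome n u x :
    rev u = u -> occ u x -> infix (singular n) u ->
    (forall j, n < j -> ~~ infix (singular j) u) ->
  exists2 k, k < shifted_fib n.+1 & u = trim k (bispecial n.+1).
Proof.
move=> ur ou /infix_split[p [q uE]] umax.
have right p' q' : u = p' ++ singular n ++ q' ->
    occ (singular n) (x + size p') /\ size q' < shifted_fib n.+1.
  move=> E; have := congr1 (@size letter) E.
  rewrite !size_cat size_singular => sE.
  have o : occ (singular n) (x + size p').
    by move: ou; rewrite E !occ_cat => /and3P[].
  split=> //; rewrite ltnNge; apply/negP => hq.
  case: (occ_singular_next o) => o'.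
    apply: (negP (umax n.+1 (ltnSn n))).
    rewrite -addnA in o'; apply: occ_infix ou o' _.
    by rewrite size_singular; lia.
  apply: (negP (umax n.+2 (ltnW (ltnSn n.+1)))).
  by apply: occ_infix ou o' _; rewrite size_singular shifted_fibSS; lia.
have uE' : u = rev q ++ singular n ++ rev p.
  by rewrite -ur uE !rev_cat rev_singular catA.
have [op sq] := right _ _ uE; have [oq sp] := right _ _ uE'.
rewrite !size_rev in oq sp.
have pq : size p = size q.
  case: (ltngtP (size p) (size q)) => // h.
    by have := occ_singular_dist op oq; rewrite ltn_add2l => /(_ h); lia.
  by have := occ_singular_dist oq op; rewrite ltn_add2l => /(_ h); lia.
have hk : (shifted_fib n.+1).-1 - size p < shifted_fib n.+1 by lia.
exists ((shifted_fib n.+1).-1 - size p) => //.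
have sB := size_bispecialS n.
apply: occ_inj ou _; last first.
  by apply/occ_trim_bispecial=> //; case/occ_singular_block: op => r rE;
    exists r; lia.
have s0 := shifted_fib_gt0 n.
have -> : size u = size p + (shifted_fib n + size q).
  by rewrite uE !size_cat size_singular.
by rewrite size_trim; lia.
Qed.

Lemma singular_inj : injective singular.
Proof.
have aux i j : i < j -> singular i <> singular j.
  move=> ij E; have : infix (singular j) (singular i) by rewrite E infix_refl.
  apply/negP; rewrite {1}(singular_trim i) singular_notin_trim //.
  by have := shifted_fib_gt0 i.+1; lia.
move=> i j E; case: (ltngtP i j) => // /aux; last by rewrite E.
by rewrite E.
Qed.

(** * Numbering of occurrences *)

Lemma count_strict_image (a : pred nat) (g : nat -> nat) q :
    (forall i j, i < j -> g i < g j) -> 0 < g 0 ->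
    (forall e, a e <-> exists i, e = g i) ->
  count a (iota 1 (g q)) = q.+1.
Proof.
move=> g_lt g0 aE.
have g_inj : injective g.
  by move=> i j E; case: (ltngtP i j) => // /g_lt; rewrite E ltnn.
rewrite -size_filter -[RHS](size_iota 0) -[RHS](size_map g).
apply: perm_size.
apply: uniq_perm => [||e].
- by rewrite filter_uniq ?iota_uniq.
- by rewrite map_inj_uniq ?iota_uniq.
rewrite mem_filter mem_iota; apply/andP/mapP => [[/aE [i ->]] h|[i]].
  exists i => //; rewrite mem_iota /=; case: (ltnP i q.+1) => // /g_lt; lia.
rewrite mem_iota /= => iq ->; split; first by apply/aE; exists i.
rewrite add0n ltnS leq_eqVlt in iq.
have gi : 0 < g i.
  by case: i {iq} => // i; apply: leq_trans g0 (ltnW (g_lt _ _ _)).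
by rewrite gi; case/predU1P: iq => [->|/g_lt]; lia.
Qed.

Lemma P_strict_image u g q :
    (forall i j, i < j -> g i < g j) -> 0 < g 0 ->
    (forall e, occurs_ending_at w u e <-> exists i, e = g i) ->
  P w u q.+1 = g q.
Proof.
move=> g_lt g0 uE; apply: xget_unique => [|y [/uE [i ->]]] /=.
  split; first by apply/uE; exists q.
  exact: count_strict_image.
by rewrite (count_strict_image _ g_lt) // => -[->].
Qed.

(** The words with the same centre are met in the same order: the p-th
occurrence of each lies in the p-th occurrence of the palindromic prefix. *)
Lemma P_trim_bispecial n k q : k < shifted_fib n.+1 ->
  P w (trim k (bispecial n.+1)) q.+1 =
  block n.+1 q + (size (bispecial n.+1) - k).
Proof.
move=> hk; have sB := size_bispecialS n; have s0 := shifted_fib_gt0 n.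
have h := leq_double_size_bispecial hk.
have d0 : 0 < size (bispecial n.+1) - k by lia.
apply: (P_strict_image (g := fun i => block n.+1 i + _)) => [i j ij||e].
- by rewrite ltn_add2r block_homo.
- by rewrite addn_gt0 d0 orbT.
rewrite /occurs_ending_at -/(occ _ _) size_trim //; split.
  case/andP=> he /(occ_trim_bispecial _ hk) [i E]; exists i; lia.
case=> i ->; apply/andP; split; first lia.
by apply/(occ_trim_bispecial _ hk); exists i; lia.
Qed.

(** * Kernels *)

(** Replaces the integer index m >= -1 by the natural number m + 1. *)
Lemma is_KerP u v : is_Ker u v <-> exists2 n, v = singular n &
  infix (singular n) u /\ forall j, n < j -> ~~ infix (singular j) u.
Proof.
have natE (i : int) : (-1 <= i)%R -> exists n, i = (n%:Z - 1)%R.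
  by move=> h; exists (absz (i + 1)%R); lia.
split=> [[m /natE [n ->] [-> i_n h]]|[n -> [i_n h]]].
  rewrite singularE in i_n *; exists n => //; split=> // j nj.
  by rewrite -singularE; apply: h; lia.
exists (n%:Z - 1)%R; first lia.
rewrite singularE; split=> // i ni.
have [j jE] : exists j, i = (j%:Z - 1)%R by apply: natE; lia.
by rewrite jE singularE; apply: h; lia.
Qed.

Lemma Ker_singular u n : Ker u = singular n <->
  infix (singular n) u /\ forall j, n < j -> ~~ infix (singular j) u.
Proof.
split=> [E|h].
  have : is_Ker u (singular n).
    by move: E; rewrite /Ker; case: xgetP => // v _ + <-.
  by case/is_KerP=> j /singular_inj ->.
apply: xget_unique => [|v]; first by apply/is_KerP; exists n.
case/is_KerP=> j -> [ju jmax]; case: h => nu nmax.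
by case: (ltngtP n j) => [/nmax|/jmax|->//]; rewrite ?ju ?nu.
Qed.

Lemma palindrome_kernelE u n :
  (palindromes w u /\ Ker u = singular n) <->
  exists2 k, k < shifted_fib n.+1 & u = trim k (bispecial n.+1).
Proof.
have sB := size_bispecialS n; have s0 := shifted_fib_gt0 n.
split=> [[[u0 ur [e /andP[_ o]]] /Ker_singular [nu nmax]]|[k hk ->]].
  exact: kernel_palindrome ur o nu nmax.
have h := leq_double_size_bispecial hk.
have o := occ_trim_bispecial0 hk.
have sT := size_trim h.
split; first split.
- by rewrite -size_eq0 sT; lia.
- by rewrite rev_trim // rev_bispecial.
- exists (k + size (trim k (bispecial n.+1))).
  by rewrite /occurs_ending_at leq_addl addnK.
apply/Ker_singular; split=> [|j]; last exact: singular_notin_trim.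
apply: (@occ_infix _ _ _ ((shifted_fib n.+1).-1 - k) o).
  apply/occ_singular_block; exists 0; rewrite block_num /num_a /= !mul0n; lia.
by rewrite sT size_singular; lia.
Qed.

End Occurrences.

(** * Beatty form of the letter counts *)

Local Open Scope ring_scope.

Lemma phi_sqr (R : realType) : phi R * phi R = 1 - phi R.
Proof.
have h : Num.sqrt 5 * Num.sqrt 5 = 5 :> R by rewrite -expr2 sqr_sqrtr.
by rewrite /phi; move: (Num.sqrt 5) h => s h; lra.
Qed.

Lemma phi_bounds (R : realType) : 0 < phi R < 1.
Proof.
have h := phi_sqr R; have s0 : 0 <= Num.sqrt 5 :> R by exact: sqrtr_ge0.
have p0 : - 2^-1 <= phi R by rewrite /phi; lra.
nra.
Qed.

(** The identity phi^2 = 1 - phi turns the bounds for n into bounds for the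
length of the image of the prefix of length n, in which the letters a number
exactly n. Strict inequalities on both sides make the induction work without
an appeal to the irrationality of phi. *)
Lemma num_a_bounds (R : realType) w (hw : fibonacci_sequence w) q :
  (num_a w q)%:R < phi R * q.+1%:R < (num_a w q).+1%:R.
Proof.
have /andP[p0 p1] := phi_bounds R; have pp := phi_sqr R.
elim/ltn_ind: q => q IH.
have step n : (n < q)%N ->
    n%:R + 1 - phi R < phi R * (expand w n).+1%:R < n%:R + 1.
  move=> /IH /andP[]; rewrite /expand -!natr1 natrD.
  move: (num_a w n)%:R n%:R => a x h1 h2.
  (* The inequalities for n, multiplied by phi; lra does not find these
     products by itself. *)
  have ppx : phi R * phi R * (x + 1) = (1 - phi R) * (x + 1) by rewrite pp.
  have lo : 0 < phi R * (a + 1 - phi R * (x + 1)) by rewrite mulr_gt0 //; lra.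
  have hi : 0 < phi R * (phi R * (x + 1) - a) by rewrite mulr_gt0 //; lra.
  by apply/andP; split; lra.
case: (expandP hw q) => [[n qE]|[n na qE]].
  case: (posnP q) => [->|q0]; first by rewrite /num_a /= mulr1; lra.
  have nq : (n < q)%N.
    move: q0; rewrite qE /expand; case: (n) => [|i _]; first by [].
    by have := num_a_gt0 hw (ltn0Sn i); lia.
  have -> : num_a w q = n by rewrite qE num_a_expand.
  by have := step n nq; rewrite -qE -!natr1; lra.
have nq : (n < q)%N by rewrite qE /expand; lia.
have [eE _] := expandSa hw na.
have := step n nq; rewrite -qE.
have -> : num_a w q = n.+1.
  by rewrite qE num_aS num_a_expand // expand_letter // eqxx addn1.
by rewrite -!natr1; lra.
Qed.

Lemma floor_phi (R : realType) w (hw : fibonacci_sequence w) q :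
  Num.floor (phi R * q.+1%:R) = (num_a w q)%:Z.
Proof.
apply: floor_def; have /andP[h1 h2] := num_a_bounds R hw q.
by rewrite (ltW h1) -[(_ + 1)%R]/((num_a w q + 1)%:Z) addn1.
Qed.

Theorem mainTheorem4 (R : realType) (FF : nat -> letter)
    (hFF : fibonacci_sequence FF) (m : int) (hm : -1 <= m)
    (p : nat) (hp : (1 <= p)%N) :
  bracket FF (K m) p =
  [set z : int |
     p%:Z * (f (m + 1))%:Z + (Num.floor (phi R * p%:R) + 1) * (f m)%:Z - 1 <= z
     <= p.+1%:Z * (f (m + 1))%:Z
        + (Num.floor (phi R * p%:R) + 1) * (f m)%:Z - 2].
Proof.
have [n ->] : exists n : nat, m = n%:Z - 1 by exists (absz (m + 1)); lia.
case: p hp => // q _.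
rewrite singularE (_ : n%:Z - 1 + 1 = n.+1%:Z - 1); last lia.
rewrite !fE (floor_phi R hFF).
have sB := size_bispecialS n.
(* Deleting k letters at both ends moves the end of an occurrence k letters to
   the left of the end of the whole palindromic prefix. *)
have PE k : (k < shifted_fib n.+1)%N ->
    (P FF (trim k (bispecial n.+1)) q.+1)%:Z =
    q.+2%:Z * (shifted_fib n.+1)%:Z +
    ((num_a FF q)%:Z + 1) * (shifted_fib n)%:Z - 2 - k%:Z.
  by move=> hk; rewrite P_trim_bispecial // block_num //; lia.
apply/seteqP; split=> z /=.
  case=> u /(palindrome_kernelE hFF) [k hk ->] <-; rewrite PE //; lia.
set hi := q.+2%:Z * _ + _ - 2 => zE.
have [k hk zk] : exists2 k, (k < shifted_fib n.+1)%N & z = hi - k%:Z.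
  by exists (absz (hi - z)); rewrite /hi in zE *; lia.
exists (trim k (bispecial n.+1)); last by rewrite PE.
by apply/(palindrome_kernelE hFF); exists k.
Qed.
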